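(* Let $m\ge 2$ and $r\ge 1$ be integers, put $d=m+r-1$ and \[ K_{m,r}=d+1-\left\lceil\frac dm\right\rceil=m+r-1-\left\lceil\frac{r-1}{m}\right\rceil . \] Then, for integers $k$ with $1\le k\le d+1$, \[ B_{m,r,k}>0\quad\Longleftrightarrow\quad 1\le k\le K_{m,r}, \] and $B_{m,r,k}=0$ for $K_{m,r}<k\le d+1$.
   Context: For an integer $d\ge 0$, $\binom{Y}{d}$ denotes the polynomial $Y(Y-1)\cdots(Y-d+1)/d!$. For integers $m\ge2$, $r\ge1$ and $d=m+r-1$, the shifted-binomial coordinates $B_{m,r,k}\in\mathbb{Q}$ ($1\le k\le d+1$) are defined as the unique rational numbers satisfying the polynomial identity in $n$ \[ \binom{mn}{d}=\sum_{k=1}^{d+1}B_{m,r,k}\binom{n+k-1}{d} \] (the polynomials $\binom{n+k-1}{d}$, $1\le k\le d+1$, form a basis of the $\mathbb{Q}$-vector space of polynomials of degree at most $d$). *)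

(* Defs.v *)
From mathcomp Require Import all_boot all_order all_algebra.

Set Implicit Arguments.
Unset Strict Implicit.
Unset Printing Implicit Defensive.

Import Order.TTheory GRing.Theory Num.Theory.

Local Open Scope ring_scope.

(* 'X('X - 1)...('X - d + 1) / d! *)
Definition binomial_poly (d : nat) : {poly rat} :=
  (d`!%:R)^-1 *: \prod_(i < d) ('X - i%:R%:P).

Definition coord_degree (m r : nat) : nat := (m + r - 1)%N.

(* The polynomial identity
     binom(m n, d) = \sum_(1 <= k <= d + 1) B_k binom(n + k - 1, d)
   in the variable n = 'X; only the values of B on 1, ..., d + 1 matter. *)
Definition shifted_binomial_identity (m d : nat) (B : nat -> rat) : bool :=
  binomial_poly d \Po (m%:R *: 'X)
  == \sum_(1 <= k < d.+2) B k *: (binomial_poly d \Po ('X + (k%:R - 1)%:P)).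

Lemma binomial_poly_nat d n : (binomial_poly d).[n%:R] = 'C(n, d)%:R.
Proof.
have E : (\prod_(i < d) ('X - i%:R%:P) : {poly rat}).[n%:R] = (n ^_ d)%:R.
  elim: d => [|d IHd]; first by rewrite big_ord0 hornerC ffactn0.
  rewrite big_ord_recr /= hornerM IHd ffactnSr natrM !hornerE.
  case: (leqP d n) => [le_dn | lt_nd]; first by rewrite natrB.
  by rewrite ffact_small // !mul0r.
have d_neq0 : d`!%:R != 0 :> rat by rewrite pnatr_eq0 -lt0n fact_gt0.
by rewrite hornerZ E -bin_ffact natrM mulrC mulfK.
Qed.

Lemma size_binomial_poly_comp d (q : {poly rat}) :
  (size q <= 2)%N -> (size (binomial_poly d \Po q)%R <= d.+1)%N.
Proof.
move=> sq; rewrite comp_polyZ (leq_trans (size_scale_leq _ _)) //.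
rewrite (leq_trans (size_comp_poly_leq _ _)) // ltnS size_prod_XsubC.
rewrite /index_enum -enumT size_enum_ord /=.
by rewrite -[leqRHS]muln1 leq_mul2l -subn1 leq_subLR sq orbT.
Qed.

Lemma eq_poly_nat d (p q : {poly rat}) :
    (size p <= d.+1)%N -> (size q <= d.+1)%N ->
    (forall i : 'I_d.+1, p.[(d - i)%:R] = q.[(d - i)%:R]) ->
  p = q.
Proof.
move=> sp sq epq; apply/eqP; rewrite -subr_eq0; apply: contraT => nz.
have := @max_poly_roots _ _ [seq (d - i)%:R | i : 'I_d.+1] nz.
rewrite size_map size_enum_ord => /(_ _ _)/wrap[].
- by apply/allP => _ /mapP[i _ ->]; rewrite /root hornerD hornerN epq subrr.
- rewrite map_inj_uniq ?enum_uniq // => i j /eqP; rewrite eqr_nat => /eqP e.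
  apply/val_inj; rewrite /= -(subKn (n := d) (m := i)) -1?ltnS //.
  by rewrite e subKn // -ltnS.
move=> lt_d; have := leq_trans lt_d (size_polyD _ _).
by rewrite size_polyN leqNgt ltnS geq_max sp sq.
Qed.

Definition shifted_binomial_mx d : 'M[rat]_d.+1 :=
  \matrix_(i, j) 'C(d - i + j, d)%:R.

Lemma shifted_binomial_mx_unit d : shifted_binomial_mx d \in unitmx.
Proof.
rewrite -unitmx_tr unitmxE det_trig.
  rewrite big1 ?unitr1 // => i _.
  by rewrite !mxE subnK -1?ltnS // binn.
apply/is_trig_mxP => i j lt_ij; rewrite !mxE bin_small //.
have le_jd : (j <= d)%N by rewrite -ltnS.
by rewrite -[ltnRHS](subnK le_jd) ltn_add2l.
Qed.

Lemma shifted_binomial_identityP m d (B : nat -> rat) :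
  reflect (shifted_binomial_mx d *m \col_(j < d.+1) B j.+1
           = \col_(i < d.+1) 'C(m * (d - i), d)%:R)
          (shifted_binomial_identity m d B).
Proof.
have lhsE n : (binomial_poly d \Po (m%:R *: 'X)).[n%:R] = 'C(m * n, d)%:R.
  have -> : 'C(m * n, d)%:R = (binomial_poly d).[m%:R * n%:R].
    by rewrite -natrM binomial_poly_nat.
  by rewrite horner_comp [(_ *: 'X).[_]]hornerZ hornerX.
have rhsE n :
    (\sum_(1 <= k < d.+2) B k *: (binomial_poly d \Po ('X + (k%:R - 1)%:P))).[n%:R]
    = \sum_(j < d.+1) 'C(n + j, d)%:R * B j.+1.
  rewrite big_add1 big_mkord horner_sum; apply: eq_bigr => j _.
  rewrite hornerZ horner_comp mulrC hornerD hornerX hornerC.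
  by rewrite -natr1 addrK -natrD binomial_poly_nat.
apply: (iffP eqP) => [e | e].
  apply/colP => i; rewrite !mxE -lhsE e rhsE.
  by apply: eq_bigr => j _; rewrite !mxE.
apply: (@eq_poly_nat d).
- apply: size_binomial_poly_comp.
  by rewrite (leq_trans (size_scale_leq _ _)) ?size_polyX.
- apply: (leq_trans (size_sum _ _ _)); apply/bigmax_leqP_seq => k _ _.
  rewrite (leq_trans (size_scale_leq _ _)) // size_binomial_poly_comp //.
  by rewrite size_XaddC.
move=> i; rewrite lhsE rhsE; move/colP/(_ i): e; rewrite !mxE => <-.
by apply: eq_bigr => j _; rewrite !mxE.
Qed.

Lemma shifted_binomial_identity_ex m d :
  exists b : {ffun 'I_d.+1 -> rat},
    shifted_binomial_identity m d (fun k => b (inord k.-1)).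
Proof.
pose v : 'cV[rat]_d.+1 :=
  invmx (shifted_binomial_mx d) *m \col_(i < d.+1) 'C(m * (d - i), d)%:R.
exists [ffun j => v j 0]; apply/shifted_binomial_identityP.
rewrite -[RHS](mulKVmx (shifted_binomial_mx_unit d)) -/v; congr (_ *m _).
by apply/colP => j; rewrite !mxE ffunE inord_val !mxE.
Qed.

(* B_{m,r,k}, chosen as the solution of the defining identity; it is the only
   one by shifted_binomial_coord_unique. *)
Definition shifted_binomial_coord (m r k : nat) : rat :=
  xchoose (shifted_binomial_identity_ex m (coord_degree m r)) (inord k.-1).

Lemma shifted_binomial_coordP m r :
  shifted_binomial_identity m (coord_degree m r) (shifted_binomial_coord m r).
Proof. exact: (xchooseP (shifted_binomial_identity_ex m (coord_degree m r))). Qed.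

Lemma shifted_binomial_coord_unique m r (B : nat -> rat) :
    shifted_binomial_identity m (coord_degree m r) B ->
  forall k, (1 <= k <= (coord_degree m r).+1)%N ->
    B k = shifted_binomial_coord m r k.
Proof.
move=> /shifted_binomial_identityP eB.
have /shifted_binomial_identityP := shifted_binomial_coordP m r.
rewrite -eB => /(can_inj (mulKmx (shifted_binomial_mx_unit _))) /colP e.
by case=> [//|k] /= lt_k; have := e (Ordinal lt_k); rewrite !mxE.
Qed.

Definition positivity_bound (m r : nat) : int :=
  (coord_degree m r)%:Z + 1
  - Num.ceil ((coord_degree m r)%:R / m%:R : rat).

(* Main.v *)
Require Import Defs.
From mathcomp Require Import all_boot all_order all_algebra.
From mathcomp Require Import ring zify.

(** Multiplying the defining identity by x^n and summing over n
    gives, since \sum_n 'C(n + k - 1, d) x^n = x^(d + 1 - k) / (1 - x)^(d + 1),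
    that B_k is the coefficient of x^(d + 1 - k) in
    (1 - x)^(d + 1) \sum_n 'C(m n, d) x^n.  Substitute x = y^m: the series
    \sum_n 'C(m n, d) y^(m n) is the part of y^d / (1 - y)^(d + 1) supported on
    the multiples of m, and this part commutes with multiplication by
    (1 - y^m)^(d + 1).  As (1 - y^m) / (1 - y) = 1 + y + ... + y^(m - 1), B_k is
    the coefficient of y^(m (d + 1 - k)) in
      y^d (1 + y + ... + y^(m - 1))^(d + 1)            (shifted_binomial_coordE).
    The coefficients of the power of the geometric polynomial are positive in
    every degree from 0 to (m - 1)(d + 1) (coef_geometric_expr_gt0).  For
    1 <= k the exponent m (d + 1 - k) - d never exceeds that top degree, so B_k
    is positive exactly when d <= m (d + 1 - k), which is k <= K_{m,r}, and it
    vanishes otherwise.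

    Power series are replaced by polynomials modulo powers of 'X: the inverse
    of (1 - 'X)^(d + 1) modulo 'X^N is neg_binomial_poly d N, and factors
    1 - 'X can be cancelled in a congruence because they are coprime to 'X. *)

Set Implicit Arguments.
Unset Strict Implicit.
Unset Printing Implicit Defensive.

Import Order.TTheory GRing.Theory Num.Theory.

Local Open Scope ring_scope.

Definition geometric_poly (m : nat) : {poly rat} := \sum_(i < m) 'X^i.

(** The truncation of the power series of (1 - 'X)^-(d + 1). *)
Definition neg_binomial_poly (d N : nat) : {poly rat} :=
  \poly_(i < N) 'C(i + d, d)%:R.

Lemma mul_geometric_poly m : (1 - 'X) * geometric_poly m = 1 - 'X^m.
Proof. by rewrite -[1 - 'X^m]opprB subrX1 -mulNr opprB. Qed.

(** Pascal's rule, with a boundary term because the series is truncated. *)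
Lemma neg_binomial_polyS d N :
  (1 - 'X) * neg_binomial_poly d.+1 N
  = neg_binomial_poly d N - 'C(N + d, d.+1)%:R *: 'X^N.
Proof.
apply/polyP => i; rewrite mulrBl mul1r !coefB coefXM !coef_poly coefZ coefXn.
case: i => [|i] /=.
  case: N => [|N] /=; first by rewrite add0n bin_small // mul0r.
  by rewrite !add0n !binn mulr0.
rewrite addSnnS; case: (ltngtP i.+1 N) => [lt_iN | lt_Ni | <-].
- by rewrite [(i + d.+2)%N]addnS binS addSnnS natrD mulr0; ring.
- by rewrite mulr0.
by rewrite mulr1 addSnnS.
Qed.

Lemma neg_binomial_poly_inv d N :
  'X^N %| 1 - (1 - 'X) ^+ d.+1 * neg_binomial_poly d N.
Proof.
elim: d => [|d IHd].
  suff -> : neg_binomial_poly 0 N = geometric_poly N.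
    by rewrite expr1 mul_geometric_poly opprB addrC subrK dvdpp.
  rewrite /neg_binomial_poly poly_def; apply: eq_bigr => i _.
  by rewrite bin0 scale1r.
rewrite exprSr -mulrA neg_binomial_polyS mulrBr opprB addrCA.
by rewrite dvdp_add // -mul_polyC !dvdp_mull.
Qed.

Lemma coef_geometric_exprS m e s :
  (geometric_poly m ^+ e.+1)`_s
  = \sum_(i < m) if (s < i)%N then 0 else (geometric_poly m ^+ e)`_(s - i).
Proof.
rewrite exprSr mulr_sumr coef_sum.
by apply: eq_bigr => i _; rewrite coefMXn.
Qed.

Lemma coef_geometric_expr_ge0 m e s : 0 <= (geometric_poly m ^+ e)`_s.
Proof.
elim: e s => [|e IHe] s; first by rewrite coef1 ler0n.
by rewrite coef_geometric_exprS sumr_ge0 // => i _; case: ifP.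
Qed.

(** Every s up to e (m - 1) is a sum of e integers in [0, m - 1]; peeling off
    the summand min(s, m - 1) keeps the rest within the bound for e - 1. *)
Lemma coef_geometric_expr_gt0 m e s :
  (0 < m)%N -> (s <= m.-1 * e)%N -> 0 < (geometric_poly m ^+ e)`_s.
Proof.
move=> m_gt0; elim: e s => [|e IHe] s le_s.
  by move: le_s; rewrite muln0 leqn0 => /eqP ->; rewrite coef1.
have lt_im : (minn s m.-1 < m)%N by lia.
rewrite coef_geometric_exprS (bigD1 (Ordinal lt_im)) //=.
rewrite ltr_pwDl ?sumr_ge0 // => [|i _]; last first.
  by case: ifP => // _; exact: coef_geometric_expr_ge0.
rewrite ltnNge geq_minl IHe //.
by move: le_s; rewrite mulnS; move: (m.-1 * e)%N => t; lia.
Qed.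

(** This is y^d ((1 - y^m) / (1 - y))^(d + 1), the numerator of
    y^d / (1 - y)^(d + 1) over the denominator (1 - y^m)^(d + 1). *)
Definition multisection_poly (m d : nat) : {poly rat} :=
  'X^d * geometric_poly m ^+ d.+1.

(** Both polynomials, once multiplied by (1 - 'X)^(d + 1), are congruent to 'X^d. *)
Lemma multisection_poly_congr m d N :
  'X^(m * N) %| multisection_poly m d * (neg_binomial_poly d N \Po 'X^m)
                - 'X^d * neg_binomial_poly d (m * N).
Proof.
have cop : coprimep ('X^(m * N) : {poly rat}) ((1 - 'X) ^+ d.+1).
  apply/coprimep_expl/coprimep_expr.
  rewrite coprimep_sym -[X in coprimep _ X]subr0 -polyC0.
  by rewrite coprimep_XsubC /root !hornerE oner_eq0.
rewrite -(Gauss_dvdpr _ cop).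
(* The inverse of (1 - 'X)^(d + 1) modulo 'X^N, evaluated at 'X^m. *)
have invH : 'X^(m * N) %|
    1 - (1 - 'X^m) ^+ d.+1 * (neg_binomial_poly d N \Po 'X^m).
  have := dvdp_comp_poly 'X^m (neg_binomial_poly_inv d N).
  rewrite comp_Xn_poly -exprM rmorphB rmorphM rmorphXn /= rmorphB /=.
  by rewrite comp_polyC comp_polyX.
have invS := neg_binomial_poly_inv d (m * N).
have := dvdp_mull 'X^d (dvdp_sub invS invH).
rewrite -mul_geometric_poly exprMn; congr (_ %| _).
rewrite /multisection_poly; ring.
Qed.

(** The coefficients of degree m n in the previous congruence:
    'X^d / (1 - 'X)^(d + 1) contributes 'C(m n, d), and the series in 'X^m
    only meets the degrees of the other factor that are multiples of m. *)
Lemma bin_multisection m d n :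
  (0 < m)%N ->
  'C(m * n, d)%:R
  = \sum_(i < n.+1) 'C(i + d, d)%:R * (multisection_poly m d)`_(m * (n - i)).
Proof.
move=> m_gt0.
have /dvdpP[q /(congr1 (fun p : {poly rat} => p`_(m * n)))] :=
  multisection_poly_congr m d n.+1.
rewrite coefMXn ltn_pmul2l // ltnSn => /eqP; rewrite coefB subr_eq0 => /eqP eqPS.
transitivity ('X^d * neg_binomial_poly d (m * n.+1))`_(m * n).
  rewrite coefXnM coef_poly; case: ltnP => [lt_d | le_d].
    by rewrite bin_small.
  by rewrite subnK // ifT //; nia.
rewrite -eqPS /neg_binomial_poly poly_def linear_sum mulr_sumr coef_sum.
apply: eq_bigr => i _; rewrite linearZ /= comp_Xn_poly -exprM -scalerAr coefZ.
by rewrite coefMXn ltn_pmul2l // ltnNge -ltnS ltn_ord /= mulnBr.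
Qed.

(** The coefficients on the right satisfy the defining identity at n = 0, ..., d,
    which is bin_multisection after the reindexing j = d - n + i; this
    determines the coordinates. *)
Lemma shifted_binomial_coordE m r k :
  (0 < m)%N -> (1 <= k <= (coord_degree m r).+1)%N ->
  shifted_binomial_coord m r k =
  (multisection_poly m (coord_degree m r))`_(m * ((coord_degree m r).+1 - k)).
Proof.
move=> m_gt0 le_k; set d := coord_degree m r in le_k *.
pose B j := (multisection_poly m d)`_(m * (d.+1 - j)).
rewrite -(shifted_binomial_coord_unique (B := B) _ le_k) //.
apply/shifted_binomial_identityP/colP => i; rewrite -/d in i *.
rewrite !mxE (bin_multisection _ _ m_gt0).
under eq_bigr => j _ do rewrite !mxE /B subSS.
have le_id : (i <= d)%N by rewrite -ltnS.
(* The row i is the value at n = d - i; its first i terms are 'C(n + j, d)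
   with n + j < d, hence zero. *)
rewrite -(big_mkord xpredT
  (fun j => 'C(d - i + j, d)%:R * (multisection_poly m d)`_(m * (d - j)))).
rewrite (big_cat_nat (n := i)) ?leqW //=.
rewrite big_nat big1 ?add0r => [|j /andP[_ lt_ji]]; last first.
  by rewrite bin_small ?mul0r //; lia.
rewrite -[in LHS](add0n (nat_of_ord i)) big_addn big_mkord subSn //.
apply: eq_bigr => j _; congr ('C(_, _)%:R * _`_(_ * _)); lia.
Qed.

Theorem proposition3p3 (m r : nat) (hm : (2 <= m)%N) (hr : (1 <= r)%N) :
  positivity_bound m r
    = m%:Z + r%:Z - 1 - Num.ceil ((r%:R - 1) / m%:R : rat)
  /\ forall k : nat, (1 <= k <= (coord_degree m r).+1)%N ->
       (0 < shifted_binomial_coord m r k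
          <-> (1 <= k)%N /\ k%:Z <= positivity_bound m r)
       /\ (positivity_bound m r < k%:Z -> shifted_binomial_coord m r k = 0).
Proof.
have m_gt0 : (0 < m)%N by lia.
have mQ_gt0 : 0 < m%:R :> rat by rewrite ltr0n.
split.
  have -> : (r%:R - 1) / m%:R = (coord_degree m r)%:R / m%:R - 1 :> rat.
    rewrite /coord_degree natrB ?natrD; last by lia.
    by field; rewrite gt_eqF.
  rewrite ceilDrz // (intrKceil (-1) : Num.ceil (-1 : rat) = -1).
  by rewrite /positivity_bound /coord_degree; move: (Num.ceil _) => c; lia.
move=> k k_range; rewrite (shifted_binomial_coordE m_gt0 k_range).
(* Since k <= d + 1, the natural subtraction below is exact. *)
have boundE : (k%:Z <= positivity_bound m r)
              = (coord_degree m r <= m * ((coord_degree m r).+1 - k))%N.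
  rewrite /positivity_bound.
  have -> c : (k%:Z <= (coord_degree m r)%:Z + 1 - c)
              = (c <= ((coord_degree m r).+1 - k)%N) by lia.
  by rewrite ceil_le_int ler_pdivrMr // -pmulrn -natrM ler_nat mulnC.
rewrite [positivity_bound m r < _]ltNge boundE /multisection_poly coefXnM.
case: leqP => [le_d | _]; last by rewrite ltxx; split=> //; split=> [|[]].
split=> //; split=> [_ | _]; first by case/andP: k_range.
(* m (d + 1 - k) - d <= m d - d <= (m - 1)(d + 1) because 1 <= k. *)
by apply: coef_geometric_expr_gt0 => //; nia.
Qed.
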